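(* Let $M=(V,D)$ be an even $\Delta$-matroid with $|V|>0$. Then $q_1(M)(-1)=0$.
   Context: A set system is $M=(V,D)$ with $V$ finite, $D$ a family of subsets of $V$; write $Z\in M$ for $Z\in D$; proper means $D\neq\emptyset$. $\oplus$ is symmetric difference; $M*X=(V,\{Z\oplus X:Z\in D\})$. For proper $M$, $d_M(X)=\min\{|X\oplus Z|:Z\in M\}$, $d_M=d_M(\emptyset)$, and $q_1(M)(y)=\sum_{X\subseteq V}y^{d_{M*X}}$. A $\Delta$-matroid is a proper set system such that for all $X,Y\in M$ and $w\in X\oplus Y$, either $X\oplus\{w\}\in M$ or some $v\in X\oplus Y$, $v\neq w$, has $X\oplus\{w,v\}\in M$. A $\Delta$-matroid is even if all its sets have the same parity of cardinality. *)

(* Defs.v *)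
(* A set system M = (V, D) is a finType V together with
   D : {set {set V}}. *)
From mathcomp Require Import all_boot all_order all_algebra.

Set Implicit Arguments.
Unset Strict Implicit.
Unset Printing Implicit Defensive.

Definition symdiff (V : finType) (X Y : {set V}) : {set V} :=
  (X :\: Y) :|: (Y :\: X).

Notation "X (+:) Y" := (symdiff X Y) (at level 50, left associativity).

Definition proper_system (V : finType) (D : {set {set V}}) : Prop :=
  D != set0.

Definition twist (V : finType) (D : {set {set V}}) (X : {set V}) :
    {set {set V}} :=
  [set Z (+:) X | Z in D].

(* d_M(X). The initial value #|V| bounds every #|X (+:) Z| from above, so
   for proper D this is the minimum over D; for D = set0 the value #|V| is
   a junk value. *)
Definition dist (V : finType) (D : {set {set V}}) (X : {set V}) : nat :=
  \big[minn/#|V|]_(Z in D) #|X (+:) Z|.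

Definition dist0 (V : finType) (D : {set {set V}}) : nat := dist D set0.

Definition q1 (V : finType) (D : {set {set V}}) : {poly int} :=
  (\sum_(X : {set V}) 'X^(dist0 (twist D X)))%R.

Definition delta_matroid (V : finType) (D : {set {set V}}) : Prop :=
  proper_system D /\
  forall X Y : {set V}, X \in D -> Y \in D ->
  forall w : V, w \in X (+:) Y ->
    X (+:) [set w] \in D \/
    exists v : V, [/\ v \in X (+:) Y, v != w & X (+:) [set w; v] \in D].

Definition even_system (V : finType) (D : {set {set V}}) : Prop :=
  forall X Y : {set V}, X \in D -> Y \in D -> odd #|X| = odd #|Y|.

Definition even_delta_matroid (V : finType) (D : {set {set V}}) : Prop :=
  delta_matroid D /\ even_system D.

(* Main.v *)
(* All Z in M have the same parity, so d_{M*X} has the parity of |Z| + |X|,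
   and q_1(M)(-1) is, up to sign, the sum of (-1)^|X| over all X. Toggling a
   fixed element of V in X flips every sign. *)
Require Import Defs.
From mathcomp Require Import all_boot all_order all_algebra.

Import Order.TTheory GRing.Theory Num.Theory.

Lemma odd_card_symdiff (V : finType) (X Y : {set V}) :
  odd #|symdiff X Y| = odd #|X| (+) odd #|Y|.
Proof.
have disj : [disjoint X :\: Y & Y :\: X].
  by rewrite -setI_eq0; apply/eqP/setP => x; rewrite !inE; do 2 case: (x \in _).
rewrite /symdiff cardsU (disjoint_setI0 disj) cards0 subn0 oddD.
(* Splitting [X] and [Y] along their intersection, [X :&: Y] is counted twice and cancels mod 2. *)
rewrite -(cardsID Y X) -(cardsID X Y) (setIC Y X) !oddD.
by do 3 case: (odd _).
Qed.

Lemma symdiffK (V : finType) (Y : {set V}) :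
  involutive (fun X : {set V} => symdiff X Y).
Proof.
by move=> X; apply/setP => x; rewrite !inE; do 2 case: (x \in _).
Qed.

Lemma dist_attained (V : finType) (D : {set {set V}}) (X : {set V}) :
  proper_system D -> exists2 Z, Z \in D & dist D X = #|symdiff X Z|.
Proof.
case/set0Pn => Z0 Z0D; rewrite /dist -minEnat.
(* The default [#|V|] exceeds no genuine minimum wrongly: it bounds every term from above, so the
   minimum is reached inside [D]. *)
rewrite (bigmin_eq_arg _ _ _ _ Z0D) => [|Z _]; last exact: max_card.
by case: arg_minP => // Z ZD _; exists Z.
Qed.

(** The minimum is the size of some [symdiff Z' X] with [Z'] in [D]; evenness lets any [Z] in [D]
    replace the unknown [Z']. *)
Lemma odd_dist0_twist (V : finType) (D : {set {set V}}) (X Z : {set V}) :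
  even_system D -> Z \in D ->
  odd (dist0 (twist D X)) = odd #|Z| (+) odd #|X|.
Proof.
move=> evD ZD; have : proper_system (twist D X).
  by apply/set0Pn; exists (symdiff Z X); exact: imset_f.
case/(dist_attained _ _ set0) => _ /imsetP[Z' Z'D ->]; rewrite /dist0 => ->.
by rewrite !odd_card_symdiff cards0 (evD _ _ Z'D ZD).
Qed.

Theorem theorem24 (V : finType) (D : {set {set V}})
    (hD : even_delta_matroid D) (hV : 0 < #|V|) :
  ((q1 D).[-1] = 0)%R.
Proof.
have [[/set0Pn[Z ZD] _] evD] := hD; have [v _] := card_gt0P hV.
rewrite /q1 horner_sum.
set S := (LHS in LHS = _).
(* [S = - S] gives twice [S] is 0, and [int] has no 2-torsion. *)
suff /eqP : (S = - S)%R by rewrite -addr_eq0 -mulr2n mulrn_eq0 => /eqP.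
(* Only the left copy is reindexed, so the terms at [symdiff X [set v]] and [X] are compared one by
   one. *)
rewrite {1}/S (reindex_inj (inv_inj (symdiffK V [set v]))) -sumrN.
apply: eq_bigr => X _; rewrite !hornerXn -signr_odd -[in RHS]signr_odd.
rewrite !(odd_dist0_twist _ _ _ Z) // odd_card_symdiff cards1 addbA.
by rewrite signr_addb mulrN1.
Qed.
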